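(* Let $\mathcal{L}$ be a finite relational signature all of whose relation symbols have arity $\geq 1$, and let $X$ be a recursive homogeneous $\mathcal{L}$-structure (with domain $\omega$) whose age is dense in $X$. Let $\beta\in \mathrm{Age}(X)$, and let $\beta_0,\beta_1,\beta_2,\ldots$ be a recursive enumeration, without repetition, of the set $[X,\beta]$ of copies of $\beta$ in $X$. For $\alpha=\alpha_0\alpha_1\alpha_2\ldots\in\{0,1\}^\omega$ let $\chi_\alpha:[X,\beta]\to\{0,1\}$ be the colouring $\chi_\alpha(\beta_i)=\alpha_i$. Then for each Kolmogorov–Chaitin complex string $\varepsilon$ there exists an embedding $\nu:X\to X$ such that $\chi_\varepsilon(\beta')=1$ for every $\beta'\in[\nu(X),\beta]$. Moreover, $\nu$ can be constructed so that it is recursive relative to $\varepsilon$.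
   Context: An $\mathcal{L}$-structure $X$ is homogeneous if every isomorphism between finite substructures of $X$ extends to an automorphism of $X$. $\mathrm{Age}(X)$ is the class of all finite $\mathcal{L}$-structures (with domain a finite ordinal) that embed into $X$. The age of $X$ is dense in $X$ if whenever $A,B\in\mathrm{Age}(X)$ and $i:A\to B$ is an embedding, there exist $C\in\mathrm{Age}(X)$ and embeddings $f_1,f_2:B\to C$ with $f_1 i=f_2 i$ and $\mathrm{Im} f_1\cap \mathrm{Im} f_2=\mathrm{Im} f_1 i=\mathrm{Im} f_2 i$. A recursive structure is one with domain $\omega$ in which every relation is a recursive subset of the appropriate $\omega^n$. For $\beta\in\mathrm{Age}(X)$ and a substructure $Y\subseteq X$, $[Y,\beta]$ denotes the set of images of embeddings of $\beta$ into $Y$. For $\alpha\in\{0,1\}^\omega$, $\overline{\alpha}(n)=\alpha_0\cdots\alpha_{n-1}$. Let $H(s)$ denote the prefix-free Kolmogorov complexity of a binary word $s$ (length of a shortest program $p$ with $U(p)=s$ for a fixed universal prefix algorithm $U$, i.e. a universal partial recursive function on binary words with prefix-free domain). An infinite binary string $\varepsilon$ is Kolmogorov–Chaitin complex (a KC-string) if $\exists m\,\forall n\; H(\overline{\varepsilon}(n))\geq n-m$. *)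

(* Defs.v *)
From Stdlib Require Cantor.
From mathcomp Require Import all_boot.
Set Implicit Arguments. Unset Strict Implicit. Unset Printing Implicit Defensive.

Definition npair (x y : nat) : nat := Cantor.to_nat (x, y).
Definition nfst (n : nat) : nat := (Cantor.of_nat n).1.
Definition nsnd (n : nat) : nat := (Cantor.of_nat n).2.

Inductive rfun : Type :=
  | RZero
  | RSucc
  | RFst
  | RSnd
  | RPair of rfun & rfun
  | RComp of rfun & rfun
  | RRec of rfun & rfun
  | RMu of rfun
  | ROracle.

Inductive eval (o : nat -> bool) : rfun -> nat -> nat -> Prop :=
  | ev_zero x : eval o RZero x 0
  | ev_succ x : eval o RSucc x x.+1
  | ev_fst x : eval o RFst x (nfst x)
  | ev_snd x : eval o RSnd x (nsnd x)
  | ev_pair f g x y z : eval o f x y -> eval o g x z -> eval o (RPair f g) x (npair y z)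
  | ev_comp f g x y z : eval o g x y -> eval o f y z -> eval o (RComp f g) x z
  | ev_rec0 f g a y : eval o f a y -> eval o (RRec f g) (npair a 0) y
  | ev_recS f g a n y z :
      eval o (RRec f g) (npair a n) y -> eval o g (npair (npair a n) y) z ->
      eval o (RRec f g) (npair a n.+1) z
  | ev_mu f x n :
      eval o f (npair x n) 0 ->
      (forall k, k < n -> exists2 v, v <> 0 & eval o f (npair x k) v) ->
      eval o (RMu f) x n
  | ev_oracle x : eval o ROracle x (if o x then 1 else 0).

Definition no_oracle : nat -> bool := fun _ => false.

Definition recursive_in (o : nat -> bool) (g : nat -> nat) : Prop :=
  exists f : rfun, forall x, eval o f x (g x).

Definition recursive (g : nat -> nat) : Prop := recursive_in no_oracle g.

Fixpoint seq_code (s : seq nat) : nat :=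
  if s is x :: s' then (npair x (seq_code s')).+1 else 0.

(* coding of binary words (bijective) *)
Fixpoint word_code (w : seq bool) : nat :=
  if w is b :: w' then (word_code w').*2 + 1 + b else 0.

(* An L-structure on the carrier T: R i s is meaningful for size s = ar i *)
Definition structure (m : nat) (T : Type) := 'I_m -> seq T -> Prop.

Definition embedding (m : nat) (ar : 'I_m -> nat) (S T : Type)
    (A : structure m S) (B : structure m T) (f : S -> T) : Prop :=
  injective f /\
  forall (i : 'I_m) (s : seq S), size s = ar i -> (A i s <-> B i (map f s)).

Definition recursive_structure (m : nat) (ar : 'I_m -> nat) (X : structure m nat) : Prop :=
  forall i : 'I_m, exists chi : nat -> nat, recursive chi /\
    forall s : seq nat, size s = ar i -> (X i s <-> chi (seq_code s) = 1).

(* homogeneity: every isomorphism between finite substructures (given by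
   enumerations a, b of their domains, a_k |-> b_k) extends to an automorphism *)
Definition homogeneous (m : nat) (ar : 'I_m -> nat) (X : structure m nat) : Prop :=
  forall a b : seq nat, uniq a -> uniq b -> size a = size b ->
    (forall (i : 'I_m) (s : seq nat), size s = ar i -> all (fun k => k < size a) s ->
        (X i (map (nth 0 a) s) <-> X i (map (nth 0 b) s))) ->
    exists g : nat -> nat, bijective g /\ embedding ar X X g /\
      forall k, k < size a -> g (nth 0 a k) = nth 0 b k.

Definition in_age (m : nat) (ar : 'I_m -> nat) (X : structure m nat)
    (n : nat) (A : structure m 'I_n) : Prop :=
  exists f : 'I_n -> nat, embedding ar A X f.

Definition age_dense (m : nat) (ar : 'I_m -> nat) (X : structure m nat) : Prop :=
  forall (a b : nat) (A : structure m 'I_a) (B : structure m 'I_b) (i : 'I_a -> 'I_b),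
    in_age ar X A -> in_age ar X B -> embedding ar A B i ->
    exists (c : nat) (C : structure m 'I_c) (f1 f2 : 'I_b -> 'I_c),
      [/\ in_age ar X C, embedding ar B C f1, embedding ar B C f2,
          (forall w, f1 (i w) = f2 (i w)) &
          forall z : 'I_c,
            (((exists x, f1 x = z) /\ (exists y, f2 y = z)) <-> (exists w, f1 (i w) = z)) /\
            ((exists w, f1 (i w) = z) <-> (exists w, f2 (i w) = z))].

(* [Y, beta] for the substructure Y of X with domain {x | Y x}: the set of
   images (subsets of omega) of embeddings of beta into Y *)
Definition copies (m : nat) (ar : 'I_m -> nat) (X : structure m nat) (Y : nat -> Prop)
    (n : nat) (beta : structure m 'I_n) (S : nat -> Prop) : Prop :=
  exists g : 'I_n -> nat, (forall k, Y (g k)) /\ embedding ar beta X g /\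
    forall x, S x <-> exists k, g k = x.

(* the finite set with canonical index c (x in set iff bit x of c is 1) *)
Definition canon_set (c : nat) : nat -> Prop := fun x => odd (c %/ 2 ^ x).

Definition rec_enum_copies (m : nat) (ar : 'I_m -> nat) (X : structure m nat)
    (n : nat) (beta : structure m 'I_n) (e : nat -> nat) : Prop :=
  [/\ recursive e, injective e,
      (forall i, copies ar X (fun _ => True) beta (canon_set (e i))) &
      (forall S, copies ar X (fun _ => True) beta S ->
         exists i, forall x, S x <-> canon_set (e i) x)].

Definition machine (u : rfun) (p s : seq bool) : Prop :=
  eval no_oracle u (word_code p) (word_code s).

Definition halts (u : rfun) (p : seq bool) : Prop := exists s, machine u p s.

Definition prefix_free (u : rfun) : Prop :=
  forall p q, halts u p -> halts u q -> prefix p q -> p = q.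

Definition universal_prefix (U : rfun) : Prop :=
  prefix_free U /\
  forall M : rfun, prefix_free M ->
    exists sigma : seq bool, forall p s, machine M p s <-> machine U (sigma ++ p) s.

(* H_U(ebar(n)) >= n - m for all n, unfolded: every U-program for the
   prefix ebar(n) has length >= n - m *)
Definition KC_complex (U : rfun) (eps : nat -> bool) : Prop :=
  exists c : nat, forall (n : nat) (p : seq bool),
    machine U p (mkseq eps n) -> (n - c <= size p)%N.

(* Main.v *)
(** The embedding is built greedily: given a partial embedding [a] of [0, ..., K-1],
    take the first [y] that extends it and for which every copy of [beta] in [a, y]
    passing through [y] has colour 1. Homogeneity and density give infinitely many [y]
    extending [a]. The sets of copies created by distinct [y] are disjoint and of
    bounded size, so for a random colouring almost surely one of these sets is entirely
    of colour 1. Hence, if no [y] worked for [eps], all prefixes of [eps] would lie in a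
    decidable set of words whose density tends to 0 along the lengths; coding a word of this
    set by its rank compresses those prefixes, contradicting complexity. *)

Require Import Defs.
From Stdlib Require Import Classical ClassicalEpsilon.
From Stdlib Require Cantor.
From mathcomp Require Import all_boot.
From mathcomp Require Import zify.
Set Implicit Arguments. Unset Strict Implicit. Unset Printing Implicit Defensive.

(** The compressing machine must work without [eps], although the earlier values of the embedding
    were found with its help. At a fixed stage these values form a single number, which enters the
    test as a constant. The machine thus depends on the stage, which is harmless: the search only
    needs that some good extension exists. To keep that search decidable in [eps], it looks for [y]
    together with a bound [B] on the indices of the new copies. A program has the form [1^d 0 r].
    The marker gives [d]; from [d] one computes the least length [L] at which the test has density
    at most [2^-(2d+1)]; and [r] holds the rank in [L - (2d+1)] letters. The total length [L - d]
    beats every additive constant, and since [d] determines the length of [r], the programs form a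
    prefix-free set. *)

Lemma nfst_pair x y : nfst (npair x y) = x.
Proof. by rewrite /nfst /npair Cantor.cancel_of_to. Qed.

Lemma nsnd_pair x y : nsnd (npair x y) = y.
Proof. by rewrite /nsnd /npair Cantor.cancel_of_to. Qed.

Definition npairE := (nfst_pair, nsnd_pair).

Lemma npair_eta q : npair (nfst q) (nsnd q) = q.
Proof.
by rewrite /npair /nfst /nsnd; case: (Cantor.of_nat q) (Cantor.cancel_to_of q).
Qed.

(** * Closure properties of oracle-recursive functions and decidable predicates *)

Section Recursive.
Variable o : nat -> bool.
Local Notation rec := (recursive_in o).

Lemma rec_ext f g : f =1 g -> rec f -> rec g.
Proof. by move=> E [c Hc]; exists c => x; rewrite -E. Qed.

Lemma rec_comp f g : rec f -> rec g -> rec (fun x => f (g x)).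
Proof.
by move=> [c Hc] [d Hd]; exists (RComp c d) => x; apply: ev_comp (Hd x) (Hc _).
Qed.

Lemma rec_pair f g : rec f -> rec g -> rec (fun x => npair (f x) (g x)).
Proof. by move=> [c Hc] [d Hd]; exists (RPair c d) => x; apply: ev_pair. Qed.

Lemma rec_id : rec (fun x => x).
Proof.
exists (RPair RFst RSnd) => x; rewrite -{2}(npair_eta x).
by apply: ev_pair; constructor.
Qed.

Lemma rec_succ f : rec f -> rec (fun x => (f x).+1).
Proof. by apply: rec_comp; exists RSucc => x; constructor. Qed.

Lemma rec_fst f : rec f -> rec (fun x => nfst (f x)).
Proof. by apply: rec_comp; exists RFst => x; constructor. Qed.

Lemma rec_snd f : rec f -> rec (fun x => nsnd (f x)).
Proof. by apply: rec_comp; exists RSnd => x; constructor. Qed.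

Lemma rec_const c : rec (fun _ => c).
Proof. by elim: c => [|c IH]; [exists RZero => x; constructor | apply: rec_succ]. Qed.

Lemma rec_comp2 h f g :
  rec (fun q => h (nfst q) (nsnd q)) -> rec f -> rec g -> rec (fun x => h (f x) (g x)).
Proof.
move=> Hh Hf Hg; have := rec_comp Hh (rec_pair Hf Hg).
by apply: rec_ext => x; rewrite !npairE.
Qed.

(** Primitive recursion with a parameter, the form to which the arithmetic and the bounded sums
    below are reduced. *)
Lemma rec_iteri s b k :
    rec (fun q => s (nfst (nfst q)) (nsnd (nfst q)) (nsnd q)) -> rec b -> rec k ->
  rec (fun x => iteri (k x) (s x) (b x)).
Proof.
move=> [c Hc] [d Hd] Hk.
have H : rec (fun q => iteri (nsnd q) (s (nfst q)) (b (nfst q))).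
  exists (RRec d c) => q; rewrite -{1}(npair_eta q).
  elim: (nsnd q) => [|n IH] /=; first by constructor.
  by apply: ev_recS IH _; have := Hc (npair (npair (nfst q) n) (iteri n (s (nfst q)) (b (nfst q)))); rewrite !npairE.
by apply: (rec_comp2 (h := fun x n => iteri n (s x) (b x)) H rec_id Hk).
Qed.

Lemma rec_add f g : rec f -> rec g -> rec (fun x => f x + g x).
Proof.
move=> Hf Hg.
have := rec_iteri (s := fun _ _ a => a.+1) (rec_succ (rec_snd rec_id)) Hg Hf.
by apply: rec_ext => x; elim: (f x) => //= n ->; rewrite addSn.
Qed.

Lemma rec_mul f g : rec f -> rec g -> rec (fun x => f x * g x).
Proof.
move=> Hf Hg.
have := rec_iteri (s := fun x _ a => g x + a)
  (rec_add (rec_comp Hg (rec_fst (rec_fst rec_id))) (rec_snd rec_id)) (rec_const 0) Hf.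
by apply: rec_ext => x; elim: (f x) => //= n ->; rewrite mulSn.
Qed.

Lemma rec_exp f g : rec f -> rec g -> rec (fun x => f x ^ g x).
Proof.
move=> Hf Hg.
have := rec_iteri (s := fun x _ a => f x * a)
  (rec_mul (rec_comp Hf (rec_fst (rec_fst rec_id))) (rec_snd rec_id)) (rec_const 1) Hg.
by apply: rec_ext => x; elim: (g x) => //= n ->; rewrite expnS.
Qed.

Lemma rec_pred f : rec f -> rec (fun x => (f x).-1).
Proof.
move=> Hf.
have := rec_iteri (s := fun _ i _ => i) (rec_snd (rec_fst rec_id)) (rec_const 0) Hf.
by apply: rec_ext => x; case: (f x).
Qed.

Lemma rec_sub f g : rec f -> rec g -> rec (fun x => f x - g x).
Proof.
move=> Hf Hg.
have := rec_iteri (s := fun _ _ a => a.-1) (rec_pred (rec_snd rec_id)) Hf Hg.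
by apply: rec_ext => x; elim: (g x) => /= [|n ->]; rewrite ?subn0 // subnS.
Qed.

Lemma rec_leq f g : rec f -> rec g -> rec (fun x => f x <= g x : nat).
Proof.
move=> Hf Hg; have := rec_sub (rec_const 1) (rec_sub Hf Hg).
by apply: rec_ext => x; rewrite /leq; case: (f x - g x).
Qed.

Lemma rec_odd f : rec f -> rec (fun x => odd (f x) : nat).
Proof.
move=> Hf.
have := rec_iteri (s := fun _ _ a => 1 - a) (rec_sub (rec_const 1) (rec_snd rec_id)) (rec_const 0) Hf.
by apply: rec_ext => x; elim: (f x) => //= n ->; case: (odd n).
Qed.

Lemma rec_half f : rec f -> rec (fun x => (f x)./2).
Proof.
move=> Hf.
have := rec_iteri (s := fun _ i a => odd i + a)
  (rec_add (rec_odd (rec_snd (rec_fst rec_id))) (rec_snd rec_id)) (rec_const 0) Hf.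
by apply: rec_ext => x; elim: (f x) => //= n ->; rewrite uphalf_half.
Qed.

Lemma rec_iter h f g : rec h -> rec f -> rec g -> rec (fun x => iter (f x) h (g x)).
Proof.
move=> Hh Hf Hg.
have := rec_iteri (s := fun _ _ a => h a) (rec_comp Hh (rec_snd rec_id)) Hg Hf.
by apply: rec_ext => x; elim: (f x) => //= n ->.
Qed.

Lemma rec_sum h k :
  rec (fun q => h (nfst q) (nsnd q)) -> rec k -> rec (fun x => \sum_(i < k x) h x i).
Proof.
move=> Hh Hk.
have := rec_iteri (s := fun x i a => a + h x i)
  (rec_add (rec_snd rec_id) (rec_comp Hh (rec_fst rec_id))) (rec_const 0) Hk.
apply: rec_ext => x; elim: (k x) => /= [|n ->]; first by rewrite big_ord0.
by rewrite big_ord_recr.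
Qed.

Definition decidable_in (P : nat -> Prop) :=
  exists2 b : nat -> bool, rec (fun x => b x) & forall x, P x <-> b x.
Local Notation dec := decidable_in.

Lemma dec_ext P Q : (forall x, P x <-> Q x) -> dec P -> dec Q.
Proof. by move=> E [b Hb Pb]; exists b => // x; rewrite -E. Qed.

Lemma dec_bool b : rec (fun x => nat_of_bool (b x)) -> dec b.
Proof. by exists b. Qed.

Lemma dec_comp P f : dec P -> rec f -> dec (fun x => P (f x)).
Proof. by move=> [b Hb Pb] Hf; exists (fun x => b (f x)); [apply: rec_comp Hb Hf|]. Qed.

Lemma dec_comp2 P f g :
  dec (fun q => P (nfst q) (nsnd q)) -> rec f -> rec g -> dec (fun x => P (f x) (g x)).
Proof.
move=> Hh Hf Hg; have := dec_comp Hh (rec_pair Hf Hg).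
by apply: dec_ext => x; rewrite !npairE.
Qed.

(** Decidability only asks that a program exist, so excluded middle may pick one of the two constant
    programs. *)
Lemma dec_const (A : Prop) : dec (fun _ => A).
Proof.
case: (classic A) => a; [exists (fun=> true)|exists (fun=> false)] => //; exact: rec_const.
Qed.

Lemma dec_not P : dec P -> dec (fun x => ~ P x).
Proof.
move=> [b Hb Pb]; exists (fun x => ~~ b x); last by move=> x; rewrite Pb; split=> /negP.
by apply: rec_ext (rec_sub (rec_const 1) Hb) => x; case: (b x).
Qed.

Lemma dec_and P Q : dec P -> dec Q -> dec (fun x => P x /\ Q x).
Proof.
move=> [b Hb Pb] [c Hc Qc]; exists (fun x => b x && c x).
  by apply: rec_ext (rec_mul Hb Hc) => x; rewrite mulnb.
by move=> x; rewrite Pb Qc; split=> /andP.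
Qed.

Lemma dec_imp P Q : dec P -> dec Q -> dec (fun x => P x -> Q x).
Proof.
move=> HP HQ; apply: dec_ext (dec_not (dec_and HP (dec_not HQ))) => x.
by split=> [H p|H [p]]; [apply: NNPP => q; apply: H | apply; apply: H].
Qed.

Lemma dec_iff P Q : dec P -> dec Q -> dec (fun x => P x <-> Q x).
Proof. by move=> HP HQ; apply: dec_and; apply: dec_imp. Qed.

Lemma dec_leq f g : rec f -> rec g -> dec (fun x => f x <= g x).
Proof. by move=> Hf Hg; apply: dec_bool; apply: rec_leq. Qed.

Lemma dec_eq f g : rec f -> rec g -> dec (fun x => f x = g x).
Proof.
move=> Hf Hg; apply: dec_ext (dec_and (dec_leq Hf Hg) (dec_leq Hg Hf)) => x.
split=> [[h1 h2]|->] //; apply/eqP; rewrite eqn_leq; exact/andP.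
Qed.

(** The truth values below the bound sum to the bound exactly when all of them are 1, so a bounded
    sum decides the quantifier. *)
Lemma dec_all P k : dec (fun q => P (nfst q) (nsnd q)) -> rec k ->
  dec (fun x => forall y, y < k x -> P x y).
Proof.
move=> [b Hb Pb] Hk.
pose h x y := b (npair x y).
have Hh : rec (fun q => h (nfst q) (nsnd q)).
  by apply: rec_ext Hb => q; rewrite /h npair_eta.
have Ph x y : P x y <-> h x y by rewrite -Pb !npairE.
exists (fun x => \sum_(i < k x) h x i == k x).
  have Hs := rec_sum (h := h) Hh Hk.
  by apply: rec_ext (rec_mul (rec_leq Hs Hk) (rec_leq Hk Hs)) => x; rewrite mulnb eqn_leq.
have Hle x K : \sum_(i < K) h x i <= K.
  by rewrite -[leqRHS]card_ord -sum1_card; apply: leq_sum => i _; case: (h x i).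
move=> x; elim: (k x) => [|K IH]; first by rewrite big_ord0.
rewrite big_ord_recr /=; split=> [H|].
  have -> : h x K by apply/Ph/H.
  by rewrite addn1 eqSS; apply/IH => y yK; apply: H; rewrite ltnS ltnW.
case E: (h x K); last by rewrite addn0 => /eqP E'; have := Hle x K; rewrite E' ltnn.
rewrite addn1 eqSS => /IH H y; rewrite ltnS leq_eqVlt => /orP[/eqP ->|]; first exact/Ph.
exact: H.
Qed.

Lemma dec_ex P k : dec (fun q => P (nfst q) (nsnd q)) -> rec k ->
  dec (fun x => exists2 y, y < k x & P x y).
Proof.
move=> HP Hk; apply: dec_ext (dec_not (dec_all (P := fun x y => ~ P x y) (dec_not HP) Hk)) => x.
split=> [H|[y yk Py] H]; last exact: (H y).
by apply: NNPP => H'; apply: H => y yk Py; apply: H'; exists y.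
Qed.

Lemma dec_all_seq (I : Type) (P : I -> nat -> Prop) (s : seq I) :
  (forall i, dec (P i)) -> dec (fun x => foldr (fun i A => P i x /\ A) True s).
Proof. by move=> HP; elim: s => [|i s IH] /=; [apply: dec_const|apply: dec_and]. Qed.

Lemma dec_all_fin (I : finType) (P : I -> nat -> Prop) :
  (forall i, dec (P i)) -> dec (fun x => forall i, P i x).
Proof.
move=> /(dec_all_seq (enum I)); apply: dec_ext => x; split.
  move=> H i; have := mem_enum I i; rewrite inE.
  elim: (enum I) H => //= j s IH [Pj H]; rewrite inE => /orP[/eqP -> //|]; exact: IH.
by move=> H; elim: (enum I) => //= j s IH.
Qed.

(** Induction on the fixed length [r]: [dec_all] handles the head, and [P'] attaches it to the code
    of the tail. [P] takes codes because programs only receive numbers. *)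
Lemma dec_all_tuples r (P : nat -> nat -> Prop) k :
    dec (fun q => P (nfst q) (nsnd q)) -> rec k ->
  dec (fun x => forall s, size s = r -> all (fun j => j < k x) s -> P x (seq_code s)).
Proof.
elim: r P k => [|r IH] P k HP Hk.
  apply: dec_ext (dec_comp2 HP rec_id (rec_const 0)) => x.
  by split=> [H [] //|H]; apply: (H [::]).
pose P' q c := P (nfst q) (npair (nsnd q) c).+1.
have HP' : dec (fun q => P' (nfst q) (nsnd q)).
  apply: dec_comp2 HP (rec_fst (rec_fst rec_id)) _; apply: rec_succ.
  exact: rec_pair (rec_snd (rec_fst rec_id)) (rec_snd rec_id).
have := IH P' (fun q => k (nfst q)) HP' (rec_comp Hk (rec_fst rec_id)).
set Q := fun x => _ => HQ.
apply: dec_ext (dec_all (P := fun x y => Q (npair x y)) _ Hk); last first.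
  by apply: dec_ext HQ => x; rewrite npair_eta.
move=> x; rewrite /Q; split=> [H [|y s] //= [Es] /andP[yk Hs]|H y yk s Es Hs].
  by have := H y yk s Es; rewrite /P' !npairE; apply.
by move: Hs; rewrite /P' !npairE => Hs; apply: (H (y :: s)) => /=; rewrite ?Es ?yk.
Qed.

(** Unbounded search for the least witness; [RMu] stops at a zero, so the negated test is what it
    runs on. *)
Lemma rec_choice (P : nat -> nat -> Prop) :
    dec (fun q => P (nfst q) (nsnd q)) -> (forall x, exists y, P x y) ->
  exists2 f, rec f & forall x, P x (f x).
Proof.
move=> [b Hb Pb] E.
have E' x : exists y, b (npair x y) by have [y Py] := E x; exists y; rewrite -Pb !npairE.
exists (fun x => ex_minn (E' x)); last first.
  by move=> x; case: ex_minnP => y /Pb; rewrite !npairE.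
have [c Hc] : rec (fun q => ~~ b q : nat).
  by apply: rec_ext (rec_sub (rec_const 1) Hb) => x; case: (b x).
exists (RMu c) => x; case: ex_minnP => y by_ ymin; constructor.
  by have := Hc (npair x y); rewrite by_.
move=> k ky; exists 1 => //; have := Hc (npair x k).
by case E1: (b _) => //; have := ymin k E1; rewrite leqNgt ky.
Qed.

End Recursive.

(** [no_oracle] always answers false, so replacing queries by [RZero] keeps the values and makes
    them independent of the oracle. This makes the recursive data of [X] available relative to
    [eps]. *)
Fixpoint drop_oracle (f : rfun) : rfun :=
  match f with
  | RPair f g => RPair (drop_oracle f) (drop_oracle g)
  | RComp f g => RComp (drop_oracle f) (drop_oracle g)
  | RRec f g => RRec (drop_oracle f) (drop_oracle g)
  | RMu f => RMu (drop_oracle f)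
  | ROracle => RZero
  | f => f
  end.

Lemma eval_drop_oracle o :
  forall f x y, eval no_oracle f x y -> eval o (drop_oracle f) x y.
Proof.
(* The recursion is on the derivation itself: [ev_mu] hides subderivations under [exists2], for
   which the generated induction principle gives no hypothesis. *)
fix IH 4 => f x y [] /=; try (move=> *; by constructor).
- by move=> g h u v w /IH Hg /IH Hh; constructor.
- by move=> g h u v w /IH Hg /IH Hh; apply: ev_comp Hg Hh.
- by move=> g h u v /IH Hg; constructor.
- by move=> g h a n v w /IH Hg /IH Hh; apply: ev_recS Hg Hh.
- move=> g u n /IH Hg H; apply: ev_mu Hg _ => k /H [v nv Hv].
  by exists v => //; apply: IH.
Qed.

Lemma recursive_relative o f : recursive f -> recursive_in o f.
Proof. by move=> [c Hc]; exists (drop_oracle c) => x; apply: eval_drop_oracle. Qed.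

(** * Counting the sets that contain no member of a disjoint family *)

Section Avoidance.
Variables (I : finType) (N : nat).
Implicit Types (F W : {set I}) (Fs : seq {set I}).

Definition avoiding Fs := [set W : {set I} | all (fun F : {set I} => ~~ (F \subset W)) Fs].

(* The map [W |-> (F :|: W, F :&: W)] is injective, and it does not change the
   trace of [W] on a set disjoint from [F]. *)
Lemma card_avoiding_cons F Fs :
    #|F| <= N -> all (fun G : {set I} => [disjoint F & G]) Fs ->
  #|avoiding Fs| <= 2 ^ N * #|avoiding Fs :\: avoiding (F :: Fs)|.
Proof.
move=> FN /allP dF; set S := avoiding Fs; set S1 := _ :\: _.
pose h W := (F :|: W, F :&: W).
have h_inj : injective h.
  move=> W W' [/setP eU /setP eI]; apply/setP => x.
  by move: (eU x) (eI x); rewrite !inE; case: (x \in F).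
have hS : h @: S \subset setX S1 (powerset F).
  apply/subsetP => _ /imsetP[W WS ->]; rewrite !inE /= subsetUl subsetIl /= andbT.
  move: WS; rewrite inE => /allP WS; apply/allP => G GFs.
  apply: contra (WS _ GFs) => /subsetP GFW; apply/subsetP => x xG.
  have := GFW x xG; rewrite inE => /orP[xF|//].
  by rewrite (disjointFr (dF _ GFs) xF) in xG.
have := subset_leq_card hS; rewrite card_imset // cardsX card_powerset => h1.
apply: leq_trans h1 _; rewrite mulnC leq_mul2r leq_exp2l ?FN ?orbT //.
Qed.

(** Each further set leaves at most the fraction [1 - 2^-N] of the survivors; multiplying by
    [(2 ^ N) ^ size Fs] keeps the estimate within the natural numbers. *)
Lemma card_avoiding Fs :
    pairwise (fun F G : {set I} => [disjoint F & G]) Fs -> all (fun F : {set I} => #|F| <= N) Fs ->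
  #|avoiding Fs| * (2 ^ N) ^ size Fs <= (2 ^ N - 1) ^ size Fs * 2 ^ #|I|.
Proof.
elim: Fs => [|F Fs IH] /=.
  rewrite !expn0 muln1 mul1n => _ _; apply: leq_trans (max_card _) _.
  by rewrite -cardsT -powersetT card_powerset cardsT.
move=> /andP[dF dFs] /andP[FN FsN]; have {}IH := IH dFs FsN.
have H := card_avoiding_cons FN dF.
have sub : avoiding (F :: Fs) \subset avoiding Fs.
  by apply/subsetP => W; rewrite !inE /= => /andP[].
have := cardsID (avoiding (F :: Fs)) (avoiding Fs).
rewrite (setIidPr sub) => E.
rewrite !expnS.
have H2 : #|avoiding (F :: Fs)| * 2 ^ N <= (2 ^ N - 1) * #|avoiding Fs| by nia.
rewrite mulnA; apply: leq_trans (leq_mul H2 (leqnn _)) _.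
by rewrite -!mulnA leq_mul2l IH orbT.
Qed.

End Avoidance.

Lemma pred_power_small M D : 0 < M -> exists j, (M - 1) ^ j * 2 ^ D <= M ^ j.
Proof.
(* Every block of [q.+1] factors gains a factor 2, by Bernoulli: [(q+1)^(q+1) >= q^(q+1) + (q+1) q^q
   >= 2 q^(q+1)]. So [D] blocks suffice. *)
case: M => // q _; rewrite subn1 /=; exists (q.+1 * D).
rewrite !expnM -expnMn; case: D => [|D]; first by rewrite !expn0.
rewrite leq_exp2r //.
have bern j : q ^ j + j * q ^ j.-1 <= q.+1 ^ j.
  elim: j => [|[|j] IH] //=; first by rewrite !expn1 expn0 muln1 addn1.
  by rewrite (expnS q.+1) [q ^ j.+2]expnS; move: IH => /=; rewrite [q ^ j.+1]expnS; nia.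
by apply: leq_trans (bern _); rewrite muln2 -addnn leq_add2l /= expnS leq_mul2r leqnSn orbT.
Qed.

Lemma bits_inj L x y : x < 2 ^ L -> y < 2 ^ L ->
  (forall i, i < L -> odd (x %/ 2 ^ i) = odd (y %/ 2 ^ i)) -> x = y.
Proof.
elim: L x y => [|L IH] x y; first by rewrite !expn0 !ltnS !leqn0 => /eqP -> /eqP ->.
rewrite !expnS => xL yL E.
have E0 : odd x = odd y by have := E 0 isT; rewrite expn0 !divn1.
have Eh : x./2 = y./2.
  apply: IH; try lia.
  by move=> i iL; have := E i.+1 iL; rewrite expnS !divnMA !divn2.
by rewrite -[x]odd_double_half -[y]odd_double_half E0 Eh.
Qed.

Lemma bits_inj_top L x y : 2 ^ L <= x < 2 ^ L.+1 -> 2 ^ L <= y < 2 ^ L.+1 ->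
  (forall i, i < L -> odd (x %/ 2 ^ i) = odd (y %/ 2 ^ i)) -> x = y.
Proof.
move=> /andP[x1 x2] /andP[y1 y2] E; apply: (bits_inj x2 y2) => i.
have top z : 2 ^ L <= z -> z < 2 ^ L.+1 -> z %/ 2 ^ L = 1.
  rewrite expnS => z1 z2; have p : 0 < 2 ^ L by rewrite expn_gt0.
  by apply/eqP; rewrite eqn_leq -ltnS ltn_divLR // leq_divRL // mul1n z1 z2.
by rewrite ltnS leq_eqVlt => /orP[/eqP ->|]; [rewrite !top | apply: E].
Qed.

(* A number [z] with [2 ^ L <= z < 2 ^ L.+1] stands for the word of length [L]
   formed by the bits of [z] below the leading one. *)
Definition rank (T : nat -> pred nat) L z := \sum_(x < z) ((2 ^ L <= x) && T L x).

(** A word in the test contains none of the sets [F y] among its positions of 1. Choosing [j]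
    candidates gives [j] disjoint sets of size at most [N], hence density at most [(1 - 2^-N)^j],
    which [pred_power_small] makes smaller than [2^-D]. *)
Lemma small_avoiding_test (C : nat -> Prop) (F : nat -> seq nat) (N : nat) (T : nat -> pred nat) :
    (forall s : seq nat, exists2 y, C y & y \notin s) ->
    (forall y, C y -> size (F y) <= N) ->
    (forall y z i, C y -> C z -> i \in F y -> i \in F z -> y = z) ->
    (forall L z y, T L z -> y < L -> C y ->
       ~ forall i, i \in F y -> i < L /\ odd (z %/ 2 ^ i)) ->
  forall D, exists L, rank T L (2 ^ L.+1) * 2 ^ D <= 2 ^ L.
Proof.
move=> Cinf FN Fdisj TF D.
have [|j Hj] := @pred_power_small (2 ^ N) D; first by rewrite expn_gt0.
have [ys [uys sys Cys]] : exists ys, [/\ uniq ys, size ys = j & forall y, y \in ys -> C y].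
  elim: j {Hj} => [|j [ys [u s H]]]; first by exists [::].
  have [y Cy ny] := Cinf ys; exists (y :: ys); split=> /=; rewrite ?ny ?s //.
  by move=> z; rewrite inE => /orP[/eqP ->|/H].
(* This [L] exceeds each chosen [y] and all elements of its set, so the hypothesis on [T] applies to
   every chosen [y] and all these positions exist in a word of length [L]. *)
pose L := (\sum_(y <- ys) (y + \sum_(i <- F y) i)).+1.
have ltL y i : y \in ys -> i \in F y -> i < L.
  by move=> yys iF; rewrite ltnS (big_rem y yys) (big_rem i iF) /=; lia.
have ltL' y : y \in ys -> y < L by move=> yys; rewrite ltnS (big_rem y yys) /=; lia.
clearbody L; exists L.
pose FS y : {set 'I_L} := [set i : 'I_L | val i \in F y].
pose Fs := map FS ys.
have cF : all (fun G : {set 'I_L} => #|G| <= N) Fs.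
  apply/allP => _ /mapP[y yys ->]; apply: leq_trans (FN _ (Cys _ yys)).
  rewrite cardE -(size_map val); apply: uniq_leq_size.
    by rewrite map_inj_uniq ?enum_uniq //; apply: val_inj.
  by move=> x /mapP[i iF ->]; move: iF; rewrite mem_enum inE.
have dF : pairwise (fun G H : {set 'I_L} => [disjoint G & H]) Fs.
  rewrite pairwise_map; move: uys Cys; elim: (ys) => //= y s IH /andP[ny us] Cs.
  rewrite IH ?andbT //; last by move=> z zs; apply: Cs; rewrite inE zs orbT.
  apply/allP => z zs /=; apply/pred0P => i /=; apply/negP; rewrite !inE => /andP[iy iz].
  have E : y = z by apply: Fdisj _ _ iy iz; apply: Cs; rewrite inE ?eqxx ?zs ?orbT.
  by rewrite E zs in ny.
have := card_avoiding dF cF; rewrite size_map sys card_ord => H.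
have rk : rank T L (2 ^ L.+1) <= #|avoiding Fs|.
  pose A := [pred z : 'I_(2 ^ L.+1) | (2 ^ L <= z) && T L z].
  have -> : rank T L (2 ^ L.+1) = #|A|.
    by rewrite -sum1_card [RHS]big_mkcond; apply: eq_bigr => z _; rewrite inE; case: ifP => // ->.
  pose g (z : 'I_(2 ^ L.+1)) : {set 'I_L} := [set i : 'I_L | odd (z %/ 2 ^ i)].
  have gi : {in A &, injective g}.
    move=> x y; rewrite !inE => /andP[x1 _] /andP[y1 _] /setP E; apply: val_inj.
    apply: (@bits_inj_top L); rewrite ?x1 ?y1 ?ltn_ord // => i iL.
    by have := E (Ordinal iL); rewrite !inE.
  rewrite -(card_in_imset gi); apply: subset_leq_card.
  apply/subsetP => x /imsetP[z zA ->]; move: zA; rewrite !inE => /andP[z1 Tz].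
  apply/allP => _ /mapP[y yys ->]; apply/negP => /subsetP sub.
  apply: (TF _ _ _ Tz (ltL' _ yys) (Cys _ yys)) => i iF; have iL := ltL _ _ yys iF.
  by split=> //; have := sub (Ordinal iL); rewrite !inE; apply.
have p0 : 0 < (2 ^ N) ^ j by rewrite !expn_gt0.
rewrite -(leq_pmul2r p0); apply: leq_trans (_ : (2 ^ N - 1) ^ j * 2 ^ L * 2 ^ D <= _).
  rewrite mulnAC leq_mul2r; apply/orP; right; apply: leq_trans H.
  by rewrite leq_mul2r rk orbT.
by rewrite mulnAC mulnC leq_mul2l Hj orbT.
Qed.

(** * Determinism of evaluation and arithmetic of word codes *)

(** Inversion for [eval]. The recursion case goes through [nfst x] and [nsnd x] because the indices
    [npair a n] are not constructor terms. *)
Lemma eval_elim o f x y : eval o f x y ->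
  match f with
  | RZero => y = 0
  | RSucc => y = x.+1
  | RFst => y = nfst x
  | RSnd => y = nsnd x
  | RPair f g => exists u v, [/\ eval o f x u, eval o g x v & y = npair u v]
  | RComp f g => exists2 u, eval o g x u & eval o f u y
  | RRec f g =>
      if nsnd x is n.+1 then
        exists2 u, eval o (RRec f g) (npair (nfst x) n) u & eval o g (npair (npair (nfst x) n) u) y
      else eval o f (nfst x) y
  | RMu f => eval o f (npair x y) 0 /\
      forall k, k < y -> exists2 v, v <> 0 & eval o f (npair x k) v
  | ROracle => y = if o x then 1 else 0
  end.
Proof.
case=> //; clear.
- by move=> f g x u v Hf Hg; exists u, v.
- by move=> f g x u y; exists u.
- by move=> f g a y; rewrite !npairE.
- by move=> f g a n u y; rewrite !npairE; exists u.
Qed.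

Lemma eval_inj o f x y z : eval o f x y -> eval o f x z -> y = z.
Proof.
elim: f x y z => [||||f IHf g IHg|f IHf g IHg|f IHf g IHg|f IHf|] x y z
  /eval_elim + /eval_elim; try (by move=> -> ->).
- by move=> [u [v [fu gv ->]]] [u' [v' [/(IHf _ _ _ fu) <- /(IHg _ _ _ gv) <- ->]]].
- by move=> [u gu fy] [u' /(IHg _ _ _ gu) <-]; apply: IHf.
- move=> Hy Hz; move: y z Hy Hz; elim: (nsnd x) => [|n IH] y z; first exact: IHf.
  move=> [u /eval_elim + gy] [u' /eval_elim + gz]; rewrite !npairE => Hu /(IH _ _ Hu) E.
  by rewrite -{u'}E in gz; apply: IHg gy gz.
- move=> [fy Hy] [fz Hz]; case: (ltngtP y z) => // [/Hz|/Hy] [v nv fv].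
    by case: nv; apply: IHf fv fy.
  by case: nv; apply: IHf fv fz.
Qed.

(** In contrast to [rec_choice], the program obtained may be partial: it diverges where [Q x] has no
    witness. A prefix-free machine has to be partial in this way. *)
Lemma eval_graph o (Q : nat -> nat -> Prop) :
    decidable_in o (fun q => Q (nfst q) (nsnd q)) ->
    (forall x y z, Q x y -> Q x z -> y = z) ->
  exists f, forall x y, eval o f x y <-> Q x y.
Proof.
move=> /dec_not[b Hb Qb] Qinj; have [c Hc] := Hb; exists (RMu c) => x y.
have evb k v : eval o c (npair x k) v -> v = b (npair x k) by move/eval_inj; apply; apply: Hc.
have bQ k : b (npair x k) <-> ~ Q x k by rewrite -Qb !npairE.
split=> [/eval_elim[/evb E _]|Qy].
  by apply: NNPP => /bQ Eb; rewrite Eb in E.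
constructor; first by have := Hc (npair x y); case E: (b _) => //; case/bQ: E.
move=> k ky; exists (b (npair x k) : nat) => //.
have : b (npair x k) by apply/bQ => /(Qinj _ _ _ Qy) E; rewrite E ltnn in ky.
by move=> ->.
Qed.

(** In binary, [(word_code w).+1] is a leading one above the letters of [w], the first letter being
    the lowest bit. This is the source of the shifts by one below. *)
Lemma word_code_bounds w : 2 ^ size w <= (word_code w).+1 < 2 ^ (size w).+1.
Proof. by elim: w => [|b w IH] //=; move: IH; rewrite !expnS; case: b => /=; lia. Qed.

Lemma size_word_code w l : 2 ^ l <= (word_code w).+1 < 2 ^ l.+1 -> size w = l.
Proof.
have /andP[w1 w2] := word_code_bounds w => /andP[l1 l2].
have E k k' : 2 ^ k < 2 ^ k'.+1 -> k <= k' by rewrite ltn_exp2l // ltnS.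
apply/eqP; rewrite eqn_leq.
by rewrite (E _ _ (leq_ltn_trans w1 l2)) (E _ _ (leq_ltn_trans l1 w2)).
Qed.

Lemma word_code_surj c : exists w, word_code w = c.
Proof.
have [k ck] := ubnP c; elim: k c ck => // k IH [|c] ck; first by exists [::].
have [|w Ew] := IH c./2; first by lia.
by exists (odd c :: w) => /=; rewrite Ew; have := odd_double_half c; lia.
Qed.

Lemma word_code_bit w i : i < size w -> odd ((word_code w).+1 %/ 2 ^ i) = nth false w i.
Proof.
elim: w i => [|b w IH] //= [|i].
  by rewrite expn0 divn1 /= addn1 /= oddD odd_double; case: b.
rewrite ltnS /= => /IH <-; congr odd; rewrite expnS divnMA divn2; congr (_ %/ _).
by case: b; lia.
Qed.

(** Prepending [true] doubles [word_code w + 2], while prepending [false] makes it the odd number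
    [2 * word_code w + 3]. The marker length is thus a 2-adic valuation, and programs can be parsed
    by arithmetic alone. *)
Lemma word_code_unary d r :
  word_code (nseq d true ++ false :: r) + 2 = 2 ^ d * (2 * word_code r + 3).
Proof. by elim: d => [|d IH] /=; rewrite ?expn0 ?expnS; lia. Qed.

Lemma word_code_unaryP p d y : word_code p + 2 = 2 ^ d * (2 * y + 3) ->
  exists2 r, p = nseq d true ++ false :: r & word_code r = y.
Proof.
have pos k : 0 < 2 ^ k by rewrite expn_gt0.
elim: d p => [|d IH] [|b w] /=.
- by rewrite expn0; lia.
- by rewrite expn0; case: b => E; [lia | exists w => //; lia].
- by rewrite expnS; have := pos d; nia.
- rewrite expnS -mulnA; case: b => E; last by lia.
  by have [|r -> <-] := IH w; [lia | exists r].
Qed.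

Lemma rank_split (T : nat -> pred nat) L z z' : z <= z' ->
  rank T L z' = rank T L z + \sum_(z <= x < z') ((2 ^ L <= x) && T L x).
Proof.
move=> zz'; rewrite /rank -!(big_mkord xpredT (fun x => (2 ^ L <= x) && T L x : nat)).
by rewrite -big_cat_nat.
Qed.

Lemma rank_lt (T : nat -> pred nat) L z z' :
  2 ^ L <= z -> T L z -> z < z' -> rank T L z < rank T L z'.
Proof.
move=> z1 Tz zz'; rewrite (rank_split _ _ (ltnW zz')) -addn1 leq_add2l.
by rewrite big_ltn ?z1 ?Tz.
Qed.

(** * Compressing the words of a sparse decidable test *)

Section Compression.
Variable T : nat -> pred nat.
Hypothesis Trec : recursive_in no_oracle (fun q => T (nfst q) (nsnd q)).

(** The exponent [2 * d + 1] pays for the [d + 1] letters of the marker and leaves a profit of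
    [d]. *)
Definition small d L := rank T L (2 ^ L.+1) * 2 ^ (2 * d + 1) <= 2 ^ L.
Definition first_small d L := small d L /\ forall L', L' < L -> ~ small d L'.

(* The word with code [z.-1] in the test is described by its rank: [p] is the code of
   the program [1^d 0 r], where [r] has code [y] and length [L - (2 * d + 1)]. *)
Definition describes d y L p z :=
  [/\ p + 2 = 2 ^ d * (2 * y + 3), 2 ^ L <= z < 2 ^ L.+1, first_small d L, T L z &
      y.+1 = 2 ^ (L - (2 * d + 1)) + rank T L z].
Definition decompress p n := exists d y L, describes d y L p n.+1.

(** Since [z] itself is counted, the total rank is positive; smallness then forces [2 * d + 1 <= L],
    so the truncated subtraction is exact. *)
Lemma describes_short d y L p z : describes d y L p z ->
  2 * d < L /\ rank T L z < 2 ^ (L - (2 * d + 1)).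
Proof.
move=> [_ /andP[z1 z2] [sm _] Tz _].
have rz := rank_lt z1 Tz z2; move: sm; rewrite /small => sm.
have dL : 2 * d + 1 <= L.
  rewrite -(leq_exp2l (m := 2)) //; apply: leq_trans sm.
  by rewrite leq_pmull //; lia.
split; first by lia.
apply: leq_trans rz _; rewrite -(leq_pmul2r (m := 2 ^ (2 * d + 1))) ?expn_gt0 //.
by rewrite -expnD subnK.
Qed.

(** The summand [2 ^ (L - (2 * d + 1))] in [y.+1] acts as a leading one above the rank: it pads [r]
    to exactly [L - (2 * d + 1)] letters. *)
Lemma decompressP p n : decompress (word_code p) n ->
  exists d y L r, [/\ describes d y L (word_code p) n.+1, p = nseq d true ++ false :: r,
    word_code r = y & size r = L - (2 * d + 1)].
Proof.
move=> [d [y [L D]]]; have [_ rz] := describes_short D.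
have [Ep _ _ _ Ey] := D; have [r Er Er'] := word_code_unaryP Ep.
exists d, y, L, r; split=> //; apply: size_word_code; rewrite Er' Ey leq_addr /=.
by rewrite expnS; lia.
Qed.

Lemma first_small_inj d L L' : first_small d L -> first_small d L' -> L = L'.
Proof. by move=> [s H] [s' H']; case: (ltngtP L L') => // [/H'|/H]. Qed.

Lemma rank_inj L z z' : 2 ^ L <= z -> 2 ^ L <= z' -> T L z -> T L z' ->
  rank T L z = rank T L z' -> z = z'.
Proof.
move=> z1 z1' Tz Tz' E; case: (ltngtP z z') => // [/(rank_lt z1 Tz)|/(rank_lt z1' Tz')].
  by rewrite E ltnn.
by rewrite E ltnn.
Qed.

Lemma find_unary d r : find negb (nseq d true ++ false :: r) = d.
Proof. by elim: d => //= d ->. Qed.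

Lemma decompress_inj p n n' : decompress p n -> decompress p n' -> n = n'.
Proof.
have [w <-] := word_code_surj p.
move=> /decompressP[d [y [L [r [[_ /andP[z1 _] sL Tz Ey] E Er _]]]]].
move=> /decompressP[d' [y' [L' [r' [[_ /andP[z1' _] sL' Tz' Ey'] E' Er' _]]]]].
have Ed : d = d' by rewrite -(find_unary d r) -E E' find_unary.
subst d'; have EL := first_small_inj sL sL'; subst L'.
have : nseq d true ++ false :: r = nseq d true ++ false :: r' by rewrite -E -E'.
move/eqP; rewrite eqseq_cat // eqxx /= eqseq_cons eqxx => /eqP Err; subst r'.
apply: succn_inj; apply: (rank_inj z1 z1' Tz Tz').
by apply/eqP; rewrite -(eqn_add2l (2 ^ (L - (2 * d + 1)))) -Ey -Ey' -Er -Er'.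
Qed.

(** The marker of [p] is also that of [q], so both have the same [d], hence the same [L] and the
    same length; a prefix of equal length is the whole word. *)
Lemma decompress_prefix p q n n' : prefix p q ->
  decompress (word_code p) n -> decompress (word_code q) n' -> p = q.
Proof.
move=> /prefixP[t Et].
move=> /decompressP[d [y [L [r [[_ _ sL _ _] E _ sr]]]]].
move=> /decompressP[d' [y' [L' [r' [[_ _ sL' _ _] E' _ sr']]]]].
have Ed : d = d'.
  by rewrite -(find_unary d' r') -E' Et E -catA cat_cons find_unary.
subst d'; have EL := first_small_inj sL sL'; subst L'.
have : size p = size q by rewrite E E' !size_cat /= sr sr'.
rewrite Et size_cat => /eqP; rewrite -{1}(addn0 (size p)) eqn_add2l eq_sym size_eq0.
by move/eqP ->; rewrite cats0.
Qed.

Lemma rec_rank o f g : recursive_in o (fun q => T (nfst q) (nsnd q)) ->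
  recursive_in o f -> recursive_in o g -> recursive_in o (fun x => rank T (f x) (g x)).
Proof.
move=> HT Hf Hg.
apply: (rec_sum (h := fun x z => (2 ^ f x <= z) && T (f x) z)) Hg.
have Hf' := rec_comp Hf (rec_fst (rec_id o)); have Hz := rec_snd (rec_id o).
apply: rec_ext (rec_mul (rec_leq (rec_exp (rec_const _ 2) Hf') Hz)
  (rec_comp2 (h := fun L z => T L z) HT Hf' Hz)) => q.
by rewrite mulnb.
Qed.

Lemma dec_small f g : recursive_in no_oracle f -> recursive_in no_oracle g ->
  decidable_in no_oracle (fun x => small (f x) (g x)).
Proof.
have H2 := rec_const no_oracle 2.
move=> Hf Hg; apply: dec_leq; last exact: rec_exp.
apply: rec_mul; first by apply: rec_rank => //; apply: rec_exp H2 (rec_succ Hg).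
exact: rec_exp H2 (rec_add (rec_mul H2 Hf) (rec_const _ 1)).
Qed.

Lemma dec_describes f1 f2 f3 f4 f5 :
    recursive_in no_oracle f1 -> recursive_in no_oracle f2 -> recursive_in no_oracle f3 ->
    recursive_in no_oracle f4 -> recursive_in no_oracle f5 ->
  decidable_in no_oracle (fun x => describes (f1 x) (f2 x) (f3 x) (f4 x) (f5 x)).
Proof.
move=> H1 H2 H3 H4 H5; have Hc := rec_const no_oracle.
pose C d y L p z := (p + 2 = 2 ^ d * (2 * y + 3) /\ (2 ^ L <= z /\ z.+1 <= 2 ^ L.+1)) /\
  ((small d L /\ forall L', L' < L -> ~ small d L') /\ (T L z /\
    y.+1 = 2 ^ (L - (2 * d + 1)) + rank T L z)).
apply: (@dec_ext _ (fun x => C (f1 x) (f2 x) (f3 x) (f4 x) (f5 x))).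
  move=> x; rewrite /C; split=> [[[a [b c]] [d [e f]]]|[a /andP[b c] d e f]] //.
  by split=> //; apply/andP.
apply: dec_and; apply: dec_and.
- apply: dec_eq; first exact: rec_add.
  apply: rec_mul; first exact: rec_exp.
  by apply: rec_add => //; apply: rec_mul.
- apply: dec_and; apply: dec_leq => //; try exact: rec_exp.
    exact: rec_succ.
  by apply: rec_exp => //; apply: rec_succ.
- apply: dec_and; first exact: dec_small.
  apply: (dec_all (P := fun x L' => ~ small (f1 x) L')) => //; apply: dec_not.
  by apply: dec_small; [apply: rec_comp H1 _; apply: rec_fst | apply: rec_snd]; apply: rec_id.
- apply: dec_and; first by apply: dec_bool; apply: (rec_comp2 (h := fun L z => T L z)).
  apply: dec_eq; first exact: rec_succ.
  apply: rec_add; last exact: rec_rank.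
  apply: rec_exp => //; apply: rec_sub => //; apply: rec_add => //; exact: rec_mul.
Qed.

Lemma decompress_machine :
  exists M, forall x y, eval no_oracle M x y <-> decompress x y.
Proof.
apply: eval_graph decompress_inj.
have I := rec_id no_oracle.
(* The witnesses are bounded by input and output: [d] and [y] are below
   [p + 2 = 2 ^ d * (2 * y + 3)], and [L < 2 ^ L <= n.+1]. *)
pose D q := exists2 d, d < (nfst q).+2 & exists2 y, y < (nfst q).+2 &
   exists2 L, L < (nsnd q).+2 & describes d y L (nfst q) (nsnd q).+1.
apply: (@dec_ext _ D).
  move=> q; split=> [[d _ [y _ [L _ H]]]|]; first by exists d, y, L.
  move=> [d [y [L H]]]; have [E /andP[z1 _] _ _ _] := H.
  have d2 : d < 2 ^ d by apply: ltn_expl.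
  have L2 : L < 2 ^ L by apply: ltn_expl.
  exists d; first by nia.
  exists y; first by nia.
  by exists L => //; lia.
apply: (dec_ex (P := fun q d => exists2 y, y < (nfst q).+2 &
   exists2 L, L < (nsnd q).+2 & describes d y L (nfst q) (nsnd q).+1)); last first.
  exact: rec_succ (rec_succ (rec_fst I)).
apply: (dec_ex (P := fun q y =>
   exists2 L, L < (nsnd (nfst q)).+2 &
     describes (nsnd q) y L (nfst (nfst q)) (nsnd (nfst q)).+1)); last first.
  exact: rec_succ (rec_succ (rec_fst (rec_fst I))).
apply: (dec_ex (P := fun q L =>
     describes (nsnd (nfst q)) (nsnd q) L (nfst (nfst (nfst q))) (nsnd (nfst (nfst q))).+1)); last first.
  exact: rec_succ (rec_succ (rec_snd (rec_fst (rec_fst I)))).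
apply: dec_describes; do ?(apply: rec_fst || apply: rec_snd || apply: rec_succ || exact: rec_id).
Qed.

Lemma small_first d : (exists L, small d L) -> exists L, first_small d L.
Proof.
move=> /ex_minnP[L sL Lmin]; exists L; split=> // L' L'L /Lmin.
by rewrite leqNgt L'L.
Qed.

(** Otherwise the prefix of length [L], the least small length for [d], has the program
    [sigma ++ 1^d 0 r] of length [size sigma + L - d]. *)
Theorem KC_complex_not_test U eps :
    universal_prefix U -> KC_complex U eps ->
    (forall D, exists L, rank T L (2 ^ L.+1) * 2 ^ D <= 2 ^ L) ->
  exists L, ~~ T L (word_code (mkseq eps L)).+1.
Proof.
move=> [_ Uuniv] [c Kc] Tsmall.
apply: NNPP => epsT'.
have epsT L : T L (word_code (mkseq eps L)).+1.
  by apply/negPn/negP => nT; apply: epsT'; exists L.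
have [M HM] := decompress_machine.
have Mpf : prefix_free M.
  move=> p q [s /HM ps] [t /HM qt] pq; exact: decompress_prefix pq ps qt.
have [sigma Hs] := Uuniv M Mpf.
(* Chosen so that the program has length [L - c - 1], one less than complexity allows. *)
pose d := (c + size sigma).+1.
have [L sL] := small_first (Tsmall (2 * d + 1)).
set w := mkseq eps L; have sw : size w = L by rewrite size_mkseq.
have wb := word_code_bounds w; rewrite sw in wb.
pose y := (2 ^ (L - (2 * d + 1)) + rank T L (word_code w).+1).-1.
have Ey : y.+1 = 2 ^ (L - (2 * d + 1)) + rank T L (word_code w).+1.
  by rewrite prednK // addn_gt0 expn_gt0.
have [r Er] := word_code_surj y.
pose p := nseq d true ++ false :: r.
have D : describes d y L (word_code p) (word_code w).+1.
  by split=> //; rewrite -Er; apply: word_code_unary.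
have Mp : machine M p w by apply/HM; exists d, y, L.
have [d2 rk] := describes_short D.
have sr : size r = L - (2 * d + 1).
  by apply: size_word_code; rewrite Er Ey leq_addr /= expnS; lia.
have /Hs/Kc := Mp.
by rewrite !size_cat size_nseq /= sr; lia.
Qed.

End Compression.

(** * One-point extensions of finite partial embeddings *)

Section Extension.
Variables (m : nat) (ar : 'I_m -> nat) (X : structure m nat).

Definition same_type (K : nat) (a b : nat -> nat) :=
  forall i t, size t = ar i -> all (fun k => k < K) t -> X i (map a t) <-> X i (map b t).

Definition inj_below (K : nat) (a : nat -> nat) :=
  forall k l, k < K -> l < K -> a k = a l -> k = l.

Definition partial_embedding K a := inj_below K a /\ same_type K id a.

Definition update (a : nat -> nat) K y k := if k == K then y else a k.

Lemma eq_map_below (T : Type) K (a b : nat -> T) t :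
  (forall k, k < K -> a k = b k) -> all (fun k => k < K) t -> map a t = map b t.
Proof. by move=> E /allP tK; apply/eq_in_map => k /tK /E. Qed.

Lemma same_type_eq K a b : (forall k, k < K -> a k = b k) -> same_type K a b.
Proof. by move=> E i t _ tK; rewrite (eq_map_below E tK). Qed.

Lemma same_type_trans K a b c : same_type K a b -> same_type K b c -> same_type K a c.
Proof. by move=> ab bc i t st tK; apply: iff_trans (ab i t st tK) (bc i t st tK). Qed.

Lemma partial_embedding_eq K a b :
  (forall k, k < K -> a k = b k) -> partial_embedding K a -> partial_embedding K b.
Proof.
move=> E [ai at_]; split; last exact: same_type_trans at_ (same_type_eq E).
by move=> k l kK lK; rewrite -!E //; apply: ai.
Qed.

Lemma partial_embedding_sub K L a : K <= L -> partial_embedding L a -> partial_embedding K a.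
Proof.
move=> KL [ai at_]; split=> [k l kK lK|i t st tK].
  by apply: ai; apply: leq_trans KL.
by apply: at_ => //; apply: sub_all tK => k kK; apply: leq_trans KL.
Qed.

Lemma embedding_comp (S T V : Type) (A : structure m S) (B : structure m T)
    (C : structure m V) f g :
  embedding ar A B f -> embedding ar B C g -> embedding ar A C (fun x => g (f x)).
Proof.
move=> [fi fA] [gi gB]; split=> [x y /gi/fi //|i s si].
by rewrite fA // gB ?size_map // -map_comp.
Qed.

Hypothesis Xhom : homogeneous ar X.

Lemma homogeneous_below K a b :
    inj_below K a -> inj_below K b -> same_type K a b ->
  exists g, [/\ bijective g, embedding ar X X g & forall k, k < K -> g (a k) = b k].
Proof.
move=> ai bi ab.
have un c : inj_below K c -> uniq (mkseq c K).
  move=> ci; rewrite map_inj_in_uniq ?iota_uniq // => k l.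
  by rewrite !mem_iota => /andP[_ kK] /andP[_ lK]; apply: ci.
have nth_c c k : k < K -> nth 0 (mkseq c K) k = c k by move=> kK; rewrite nth_mkseq.
have [||g [gb [ge Eg]]] := Xhom (un a ai) (un b bi); first by rewrite !size_mkseq.
  move=> i t st; rewrite size_mkseq => tK.
  by rewrite !(eq_map_below (nth_c _) tK); apply: ab.
exists g; split=> // k kK.
by have := Eg k; rewrite size_mkseq => /(_ kK); rewrite !nth_c.
Qed.

Hypothesis Xdense : age_dense ar X.

Variables (K : nat) (a : nat -> nat).
Hypothesis a_emb : partial_embedding K a.

Let cand y := partial_embedding K.+1 (update a K y).

Lemma cand_new y k : cand y -> k < K -> a k <> y.
Proof.
move=> [ui _] kK E; have := ui k K; rewrite /update eqxx (ltn_eqF kK) => H.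
by have := H (ltnW kK) (ltnSn K) E; apply/eqP; rewrite neq_ltn kK.
Qed.

Lemma cand_ext y :
  (forall k, k < K -> a k <> y) -> same_type K.+1 id (update a K y) -> cand y.
Proof.
move=> ny st; split=> // k l; rewrite /update !ltnS [k <= _]leq_eqVlt [l <= _]leq_eqVlt.
case: eqVneq => [->|nk] /=; case: eqVneq => [->|nl] //= kK lK.
- by move=> E; case: (ny _ lK).
- by move=> E; case: (ny _ kK).
- exact: (proj1 a_emb).
Qed.

(** Homogeneity extends the finite isomorphism [k |-> a k] to an automorphism, whose value at [K] is
    a candidate. *)
Lemma cand_exists : exists y, cand y.
Proof.
have [|g [gb [gi gX] Eg]] := homogeneous_below _ (proj1 a_emb) (proj2 a_emb); first by move=> k l.
exists (g K); apply: partial_embedding_eq (_ : partial_embedding _ g).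
  move=> k; rewrite ltnS leq_eqVlt /update; case: eqVneq => [-> //|_] /= kK; exact: Eg.
by split=> [k l _ _ /gi //|i t st _]; rewrite map_id; apply: gX.
Qed.

(* If [ys] lists all realisations of the type over [a], amalgamating two copies of
   [a ++ ys] over [a] produces twice as many realisations. *)
Lemma cand_infinite (s : seq nat) : exists2 y, cand y & y \notin s.
Proof.
apply: NNPP => H.
have {H} sP y : cand y -> y \in s.
  by move=> cy; apply/negPn/negP => ys; apply: H; exists y.
pose candb y : bool := excluded_middle_informative (cand y).
have candP y : reflect (cand y) (candb y).
  by rewrite /candb; case: excluded_middle_informative => c; constructor.
pose ys := undup (filter candb s); pose r := size ys.
have ysP y : y \in ys <-> cand y.
  rewrite mem_undup mem_filter; split; first by case/andP => /candP.
  by move=> cy; rewrite sP // andbT; apply/candP.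
have r0 : 0 < r.
  by have [y /ysP] := cand_exists; rewrite /r; case: (ys).
pose b (k : 'I_(K + r)) := if k < K then a k else nth 0 ys (k - K).
pose A : structure m 'I_K := fun i t => X i (map (fun k : 'I_K => a k) t).
pose B : structure m 'I_(K + r) := fun i t => X i (map b t).
have bl (w : 'I_K) : b (lshift r w) = a w by rewrite /b /= ltn_ord.
have br (j : 'I_r) : b (rshift K j) = nth 0 ys j by rewrite /b /= ltnNge leq_addr addKn.
have ysj (j : 'I_r) : cand (nth 0 ys j) by apply/ysP/mem_nth.
have bi : injective b.
  move=> k l; rewrite -(splitK k) -(splitK l).
  case: (split k) => w; case: (split l) => v /=; rewrite ?bl ?br.
  - by move=> E; congr lshift; apply: val_inj; apply: (proj1 a_emb); rewrite ?ltn_ord.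
  - by move/(cand_new (ysj v) (ltn_ord w)).
  - by move/esym/(cand_new (ysj w) (ltn_ord v)).
  - by move/eqP; rewrite nth_uniq ?undup_uniq // => /eqP E; congr rshift; apply: val_inj.
have eA : embedding ar A X (fun k : 'I_K => a k).
  by split=> // k l E; apply: val_inj; apply: (proj1 a_emb); rewrite ?ltn_ord.
have eB : embedding ar B X b by split.
have eAB : embedding ar A B (lshift r).
  split=> [|i t st]; first exact: lshift_inj.
  by rewrite /A /B -map_comp; rewrite (eq_map (g := fun k : 'I_K => a k)).
have [||c [C [f1 [f2 [[h eh] ef1 ef2 E12 Eim]]]]] := Xdense (i := lshift r) _ _ eAB.
- by exists (fun k : 'I_K => a k).
- by exists b.
have e1 := embedding_comp ef1 eh; have e2 := embedding_comp ef2 eh.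
(* [phi] moves [a] onto the common part of the two copies inside the amalgam, so its inverse [psi]
   brings both copies back over [a] itself. The default [0] is only taken outside the indices below
   [K]. *)
have [||phi [[psi phiK psiK] [phi_inj phiX] Ephi]] :=
    @homogeneous_below K a (fun k => if insub k is Some w then h (f1 (lshift r w)) else 0) (proj1 a_emb).
- move=> k l kK lK; rewrite !insubT => /(proj1 e1)/lshift_inj E.
  by move/(congr1 val): E.
- have eA1 := embedding_comp eAB e1.
  move=> i t st tK.
  have [t' Et] : exists t' : seq 'I_K, t = map val t'.
    exists (pmap insub t); elim: (t) tK => //= k t0 IH /andP[kK /IH {1}->].
    by rewrite insubT.
  rewrite Et size_map in st; rewrite Et -!map_comp.
  apply: iff_trans (iff_trans (iff_sym (proj2 eA i t' st)) (proj2 eA1 i t' st)) _.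
  by rewrite (eq_map (g := fun w => h (f1 (lshift r w)))) // => w /=; rewrite valK.
have {}Ephi (w : 'I_K) : phi (a w) = h (f1 (lshift r w)) by rewrite Ephi // valK.
have realise (f : 'I_(K + r) -> nat) (j : 'I_r) : embedding ar B X f ->
    (forall w, f (lshift r w) = phi (a w)) -> psi (f (rshift K j)) \in ys.
  move=> ef Ef; apply/ysP; apply: cand_ext.
    move=> k kK; move=> /(congr1 phi); rewrite psiK -(Ef (Ordinal kK)) => /(proj1 ef) /eqP.
    by rewrite eq_lrshift.
  (* Renumbers [0, ..., K] inside [B], with [K] sent to the [j]-th realisation; the default of
     [insubd] does not occur below [K]. *)
  pose idx k := if k == K then rshift K j else insubd (rshift K j) k.
  apply: same_type_trans (proj2 (ysj j)) _ => i t st tK.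
  have idxl k (kK : k < K) : idx k = lshift r (Ordinal kK).
    apply: val_inj; rewrite /idx (ltn_eqF kK) val_insubd /=.
    by rewrite (leq_trans kK (leq_addr _ _)).
  have idxK : idx K = rshift K j by rewrite /idx eqxx.
  have E1 : map (update a K (nth 0 ys j)) t = map b (map idx t).
    rewrite -map_comp; apply: eq_map_below tK => k; rewrite ltnS leq_eqVlt /update /=.
    case: eqVneq => [-> _|nk /= kK]; first by rewrite idxK br.
    by rewrite (idxl _ kK) bl.
  have E2 : map phi (map (update a K (psi (f (rshift K j)))) t) = map f (map idx t).
    rewrite -!map_comp; apply: eq_map_below tK => k; rewrite ltnS leq_eqVlt /update /=.
    case: eqVneq => [-> _|nk /= kK]; first by rewrite idxK psiK.
    by rewrite (idxl _ kK) Ef.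
  apply: iff_trans _ (iff_sym (phiX i _ _)); last by rewrite size_map.
  by rewrite E1 E2; apply: (proj2 ef); rewrite size_map.
pose u1 (j : 'I_r) := psi (h (f1 (rshift K j))).
have u1_in j : u1 j \in ys by apply: (realise (fun k => h (f1 k))).
pose j0 := Ordinal r0.
have u2_in : psi (h (f2 (rshift K j0))) \in ys.
  by apply: (realise (fun k => h (f2 k))) => // w; rewrite -E12.
have u1_inj : injective u1.
  by move=> j j' /(can_inj psiK)/(proj1 e1)/rshift_inj.
(* The [r] distinct points from the first copy already exhaust [ys], so a point from the second copy
   must coincide with one of them. *)
have [|||_ E] := @uniq_min_size _ (map u1 (enum 'I_r)) ys.
- by rewrite map_inj_uniq ?enum_uniq.
- by move=> _ /mapP[j _ ->].
- by rewrite size_map size_enum_ord.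
move: u2_in; rewrite -E => /mapP[j _] /(can_inj psiK)/(proj1 eh) Ej.
(* The coincidence puts a new point in both images, hence in the image of [A], which contains no new
   point. *)
have [[+ _] _] := Eim (f1 (rshift K j)); case.
  by split; [exists (rshift K j) | exists (rshift K j0)].
by move=> w /(proj1 ef1)/eqP; rewrite eq_lrshift.
Qed.

End Extension.

(* The finite sequence [a 0, ..., a K.-1] is stored as [npair (... (npair 0 (a 0)) ...) (a K.-1)]. *)
Definition look v K j := nsnd (iter (K - j.+1) nfst v).

Lemma look_push v y K j : j < K.+1 -> look (npair v y) K.+1 j = update (look v K) K y j.
Proof.
rewrite ltnS leq_eqVlt /look /update subSS; case: eqVneq => [-> _|_ /= jK].
  by rewrite subnn /= nsnd_pair.
by rewrite -(subnSK jK) iterSr nfst_pair.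
Qed.

(** * Computing with codes of finite sequences and finite sets *)

Fixpoint map_code r (f : nat -> nat) c :=
  if r is r'.+1 then (npair (f (nfst c.-1)) (map_code r' f (nsnd c.-1))).+1 else 0.

Lemma map_codeE f t : map_code (size t) f (seq_code t) = seq_code (map f t).
Proof. by elim: t => //= x t IH; rewrite !npairE IH. Qed.

Definition nth_code c j := nfst (iter j (fun c => nsnd c.-1) c).-1.

Lemma nth_codeE t j : nth_code (seq_code t) j = nth 0 t j.
Proof.
rewrite /nth_code; elim: t j => [|x t IH] [|j]; rewrite ?iterSr /= ?npairE //.
(* Past the end the decoder stays at 0, because 0 codes the pair [(0, 0)]; this matches the default
   of [nth]. *)
by rewrite (_ : nsnd 0 = 0) // (_ : iter j _ 0 = 0) //; elim: j => //= j ->.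
Qed.

Lemma rec_bit o f g : recursive_in o f -> recursive_in o g ->
  recursive_in o (fun x => odd (f x %/ 2 ^ g x)).
Proof.
move=> Hf Hg; apply: rec_odd.
have E c j : iter j half c = c %/ 2 ^ j.
  by elim: j => [|j IH] /=; rewrite ?expn0 ?divn1 // IH expnSr divnMA divn2.
apply: rec_ext (rec_iter (rec_half (rec_id o)) Hg Hf) => x; exact: E.
Qed.

Lemma canon_set_lt c x : canon_set c x -> x < c.
Proof.
rewrite /canon_set => H; apply: leq_trans (ltn_expl x (isT : 1 < 2)) _.
by rewrite leqNgt; apply/negP => /divn_small E; rewrite E in H.
Qed.

Lemma canon_set_inj c d : (forall x, canon_set c x <-> canon_set d x) -> c = d.
Proof.
move=> E; apply: (@bits_inj (c + d)).
- by apply: leq_trans (ltn_expl c (isT : 1 < 2)) _; rewrite leq_exp2l // leq_addr.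
- by apply: leq_trans (ltn_expl d (isT : 1 < 2)) _; rewrite leq_exp2l // leq_addl.
- by move=> i _; apply/idP/idP => /E.
Qed.

(** * Decidability of the greedy extension condition *)

Section Decidability.
Variables (m : nat) (ar : 'I_m -> nat) (X : structure m nat).
Hypothesis Xrec : recursive_structure ar X.
Variable o : nat -> bool.
Local Notation rec := (recursive_in o).
Local Notation dec := (decidable_in o).

Lemma rec_look fv fK fj : rec fv -> rec fK -> rec fj -> rec (fun x => look (fv x) (fK x) (fj x)).
Proof.
move=> Hv HK Hj; apply: rec_snd.
by apply: (rec_iter (rec_fst (rec_id o)) (rec_sub HK (rec_succ Hj))).
Qed.

Lemma rec_nth_code f g : rec f -> rec g -> rec (fun x => nth_code (f x) (g x)).
Proof.
move=> Hf Hg; apply: rec_fst; apply: rec_pred.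
exact: (rec_iter (rec_snd (rec_pred (rec_id o))) Hg Hf).
Qed.

Lemma rec_map_code r (a : nat -> nat -> nat) f :
  rec (fun q => a (nfst q) (nsnd q)) -> rec f -> rec (fun x => map_code r (a x) (f x)).
Proof.
move=> Ha; elim: r f => [|r IH] f Hf /=; first exact: rec_const.
apply: rec_succ; apply: rec_pair; last by apply: IH; apply: rec_snd; apply: rec_pred.
by apply: (rec_comp2 (h := a) Ha (rec_id o)); apply: rec_fst; apply: rec_pred.
Qed.

Lemma dec_same_type (a b : nat -> nat -> nat) K :
    rec (fun q => a (nfst q) (nsnd q)) -> rec (fun q => b (nfst q) (nsnd q)) -> rec K ->
  dec (fun x => same_type ar X (K x) (a x) (b x)).
Proof.
move=> Ha Hb HK; apply: dec_all_fin => i; have [chi [Hchi chiP]] := Xrec i.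
have {}Hchi := recursive_relative o Hchi.
pose P x c := chi (map_code (ar i) (a x) c) = 1 <-> chi (map_code (ar i) (b x) c) = 1.
apply: dec_ext (dec_all_tuples (ar i) (P := P) _ HK).
  move=> x; split=> H t st tK; have := H t st tK.
    by rewrite /P -st !map_codeE -!chiP ?size_map.
  by rewrite /P -st !map_codeE -!chiP ?size_map.
have Hc := rec_const o 1; have I := rec_id o.
apply: dec_iff; apply: dec_eq => //; apply: (rec_comp Hchi).
  apply: (rec_map_code _ (a := fun q => a (nfst q))) => //; last exact: rec_snd.
  by apply: (rec_comp2 Ha); [do 2!apply: rec_fst | apply: rec_snd].
apply: (rec_map_code _ (a := fun q => b (nfst q))) => //; last exact: rec_snd.
by apply: (rec_comp2 Hb); [do 2!apply: rec_fst | apply: rec_snd].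
Qed.

Lemma dec_inj_below (a : nat -> nat -> nat) K :
    rec (fun q => a (nfst q) (nsnd q)) -> rec K -> dec (fun x => inj_below (K x) (a x)).
Proof.
move=> Ha HK; have I := rec_id o.
pose P x k := forall l, l < K x -> a x k = a x l -> k = l.
apply: (@dec_ext _ (fun x => forall k, k < K x -> P x k)).
  by move=> x; split=> [H k l kK|H k kK l]; [apply: H | apply: H].
apply: dec_all => //.
apply: (dec_all (P := fun q l => a (nfst q) (nsnd q) = a (nfst q) l -> nsnd q = l)); last first.
  by apply: (rec_comp HK); apply: rec_fst.
have I1 := rec_fst (rec_fst I); have I2 := rec_snd (rec_fst I); have I3 := rec_snd I.
by apply: dec_imp; apply: dec_eq => //; apply: (rec_comp2 (h := a)).
Qed.

Lemma dec_partial_embedding (a : nat -> nat -> nat) K :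
    rec (fun q => a (nfst q) (nsnd q)) -> rec K ->
  dec (fun x => partial_embedding ar X (K x) (a x)).
Proof.
move=> Ha HK; apply: dec_and; first exact: dec_inj_below.
by apply: (dec_same_type (a := fun _ => id)) => //; apply: rec_snd; apply: rec_id.
Qed.

Variables (n : nat) (b0 : nat -> nat) (e : nat -> nat).
Hypothesis e_rec : recursive e.
Hypothesis b0_rec : rec b0.

Definition copy_seq b := inj_below n b /\ same_type ar X n b0 b.

(** A bounded form of the statement that [c] is the canonical index of the set of values of [b]
    below [n]. The bound [x < c] loses nothing, by [canon_set_lt]. *)
Definition image_code c (b : nat -> nat) := (forall j, j < n -> canon_set c (b j)) /\
  (forall x, x < c -> canon_set c x -> exists2 j, j < n & b j = x).

(* [Al i] stands for "the colour of the [i]-th copy is 1"; only indices below [B] are used. *)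
Definition good_copy (Al : nat -> Prop) K w B c :=
  let b j := look w K.+1 (nth_code c j) in
  (exists2 j, j < n & nth_code c j = K) -> copy_seq b ->
  exists2 i, i < B & Al i /\ image_code (e i) b.

(** Only copies through the newest index [K] are examined, the others belonging to earlier stages.
    The colouring [Al] is a parameter because the condition is used twice: with the bits of a number
    in the test, and with [eps] in the search. *)
Definition good Al K w B :=
  partial_embedding ar X K.+1 (look w K.+1) /\
  forall s, size s = n -> all (fun k => k < K.+1) s -> good_copy Al K w B (seq_code s).

Lemma dec_image_code f (b : nat -> nat -> nat) :
  rec f -> rec (fun q => b (nfst q) (nsnd q)) -> dec (fun x => image_code (f x) (b x)).
Proof.
move=> Hf Hb; have I := rec_id o; have Hn := rec_const o n.
apply: dec_and.
  apply: (dec_all (P := fun x j => canon_set (f x) (b x j))) => //.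
  apply: dec_bool; apply: rec_bit => //; apply: (rec_comp Hf); exact: rec_fst.
apply: (dec_all (P := fun x y => canon_set (f x) y -> exists2 j, j < n & b x j = y)) => //.
apply: dec_imp.
  by apply: dec_bool; apply: rec_bit; [apply: (rec_comp Hf); apply: rec_fst | apply: rec_snd].
apply: (dec_ex (P := fun q j => b (nfst q) j = nsnd q)) => //.
apply: dec_eq; last by apply: rec_snd; apply: rec_fst.
by apply: (rec_comp2 (h := b) Hb); [do 2!apply: rec_fst | apply: rec_snd].
Qed.

Lemma dec_good_copy (Al : nat -> nat -> Prop) fK fw fB fc :
    dec (fun q => Al (nfst q) (nsnd q)) -> rec fK -> rec fw -> rec fB -> rec fc ->
  dec (fun x => good_copy (Al x) (fK x) (fw x) (fB x) (fc x)).
Proof.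
move=> HAl HK Hw HB Hc; have I := rec_id o; have Hn := rec_const o n.
pose b x j := look (fw x) (fK x).+1 (nth_code (fc x) j).
have Hb : rec (fun q => b (nfst q) (nsnd q)).
  apply: rec_look; first by apply: (rec_comp Hw); apply: rec_fst.
    by apply: rec_succ; apply: (rec_comp HK); apply: rec_fst.
  by apply: rec_nth_code; [apply: (rec_comp Hc); apply: rec_fst | apply: rec_snd].
apply: dec_imp.
  apply: (dec_ex (P := fun x j => nth_code (fc x) j = fK x)) => //.
  apply: dec_eq; last by apply: (rec_comp HK); apply: rec_fst.
  by apply: rec_nth_code; [apply: (rec_comp Hc); apply: rec_fst | apply: rec_snd].
apply: dec_imp.
  apply: dec_and; first exact: (dec_inj_below (a := b)).
  apply: (dec_same_type (a := fun _ => b0) (b := b)) => //.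
  by apply: (rec_comp b0_rec); apply: rec_snd.
apply: (dec_ex (P := fun x i => Al x i /\ image_code (e i) (b x))) => //.
apply: dec_and => //.
apply: (dec_image_code (b := fun q => b (nfst q))).
  by apply: (rec_comp (recursive_relative o e_rec)); apply: rec_snd.
by apply: (rec_comp2 (h := b) Hb); [do 2!apply: rec_fst | apply: rec_snd].
Qed.

Lemma dec_good (Al : nat -> nat -> Prop) fK fw fB :
    dec (fun q => Al (nfst q) (nsnd q)) -> rec fK -> rec fw -> rec fB ->
  dec (fun x => good (Al x) (fK x) (fw x) (fB x)).
Proof.
move=> HAl HK Hw HB; have I := rec_id o.
apply: dec_and.
  apply: (dec_partial_embedding (a := fun x => look (fw x) (fK x).+1)); last exact: rec_succ.
  apply: rec_look; first by apply: (rec_comp Hw); apply: rec_fst.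
    by apply: rec_succ; apply: (rec_comp HK); apply: rec_fst.
  exact: rec_snd.
apply: (dec_all_tuples n (P := fun x c => good_copy (Al x) (fK x) (fw x) (fB x) c));
  last exact: rec_succ.
have C f : rec f -> rec (fun q => f (nfst q)) by move=> Hf; apply: (rec_comp Hf); apply: rec_fst.
apply: (dec_good_copy (Al := fun q => Al (nfst q))); try exact: C.
  by apply: (dec_comp2 (P := Al) HAl); [do 2!apply: rec_fst | apply: rec_snd].
exact: rec_snd.
Qed.

End Decidability.

(** * The greedy construction relative to the random colouring *)

Section Greedy.
Variables (m : nat) (ar : 'I_m -> nat) (X : structure m nat).
Hypotheses (Xrec : recursive_structure ar X) (Xhom : homogeneous ar X).
Hypothesis Xdense : age_dense ar X.
Variables (n : nat) (beta : structure m 'I_n) (b0 : nat -> nat) (e : nat -> nat).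
Hypothesis b0_emb : embedding ar beta X (fun k : 'I_n => b0 k).
Hypothesis b0_rec : recursive b0.
Hypothesis he : rec_enum_copies ar X beta e.

Local Notation good := (good ar X n b0 e).
Local Notation copy_seq := (copy_seq ar X n b0).
Local Notation image_code := (image_code n).

Lemma seq_ordP K (t : seq nat) : all (fun k => k < K) t -> exists t' : seq 'I_K, t = map val t'.
Proof.
elim: t => [|k t IH] /=; first by exists [::].
by move=> /andP[kK /IH[t' ->]]; exists (Ordinal kK :: t').
Qed.

Lemma copy_seqP b : copy_seq b <-> embedding ar beta X (fun k : 'I_n => b k).
Proof.
split=> [[bi bt]|[bi bX]].
  split=> [k l E|i t st]; first by apply: val_inj; apply: bi; rewrite ?ltn_ord.
  apply: iff_trans (proj2 b0_emb i t st) _.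
  have := bt i (map val t); rewrite size_map -!map_comp; apply=> //.
  by rewrite all_map; apply/allP => k _ /=.
split=> [k l kn ln E|i t st /seq_ordP[t' E]].
  by case: (bi (Ordinal kn) (Ordinal ln) E).
rewrite E size_map in st; rewrite E -!map_comp.
exact: iff_trans (iff_sym (proj2 b0_emb i t' st)) (bX i t' st).
Qed.

Lemma image_codeP c b : image_code c b <->
  forall x, canon_set c x <-> exists k : 'I_n, b k = x.
Proof.
split=> [[H1 H2] x|H].
  split=> [cx|[k <-]]; last by apply: H1; rewrite ltn_ord.
  by have [j jn <-] := H2 x (canon_set_lt cx) cx; exists (Ordinal jn).
split=> [j jn|x _ /H[k <-]]; last by exists (val k) => //; rewrite ltn_ord.
by apply/H; exists (Ordinal jn).
Qed.

Lemma copy_index b : copy_seq b -> exists i, image_code (e i) b.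
Proof.
have [_ _ _ e_surj] := he.
move=> /copy_seqP bX; have [|i ei] := e_surj (fun x => exists k : 'I_n, b k = x).
  by exists (fun k : 'I_n => b k).
by exists i; apply/image_codeP => x; rewrite ei.
Qed.

Lemma copy_seq_eq b b' : b =1 b' -> copy_seq b -> copy_seq b'.
Proof.
move=> E [bi bt]; split; first by move=> k l kn ln; rewrite -!E; apply: bi.
by apply: same_type_trans bt _; apply: same_type_eq.
Qed.

Lemma image_code_eq c b b' : b =1 b' -> image_code c b -> image_code c b'.
Proof.
by move=> E [H1 H2]; split=> [j /H1|x xc /(H2 x xc)[j jn <-]]; [rewrite E | exists j].
Qed.

(** Allows the colouring read off a finite word to be replaced by [eps]. *)
Lemma good_local Al Al' K w B :
  (forall i, i < B -> Al i -> Al' i) -> good Al K w B -> good Al' K w B.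
Proof.
move=> E [ext H]; split=> // s ss sK b KS cs; have [i iB [Ai Hi]] := H s ss sK KS cs.
by exists i => //; split=> //; apply: E.
Qed.

Section Step.
Variables (U : rfun) (eps : nat -> bool).
Hypotheses (hU : universal_prefix U) (heps : KC_complex U eps).
Variables (K v : nat).
Hypothesis v_emb : partial_embedding ar X K (look v K).

Let C y := partial_embedding ar X K.+1 (look (npair v y) K.+1).
Let tup (y : nat) (t : n.-tuple 'I_K.+1) j := look (npair v y) K.+1 (nth 0 (map val t) j).
Let newcopy y t := copy_seq (tup y t) /\ exists2 j, j < n & nth 0 (map val t) j = K.
Let index y t := epsilon (inhabits 0) (fun i => image_code (e i) (tup y t)).
Let newcopies y := [seq t <- enum {: n.-tuple 'I_K.+1} |
  (excluded_middle_informative (newcopy y t) : bool)].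
(** Its length is at most the number of [n]-tuples of indices up to [K], uniformly in [y]. [F]
    serves only the density estimate, so it may rest on classical choice. *)
Let F y := map (index y) (newcopies y).

Lemma newcopiesP y t : t \in newcopies y <-> newcopy y t.
Proof.
rewrite mem_filter mem_enum andbT; case: excluded_middle_informative => //.
Qed.

Lemma indexP y t : newcopy y t -> image_code (e (index y t)) (tup y t).
Proof. by move=> [/copy_index ex _]; apply: (epsilon_spec (inhabits 0) _ ex). Qed.

Lemma new_infinite (s : seq nat) : exists2 y, C y & y \notin s.
Proof.
have [y Cy ys] := cand_infinite Xhom Xdense v_emb s; exists y => //.
by apply: partial_embedding_eq Cy => k kK; rewrite look_push.
Qed.

(* A copy through the new point [y] has all its other points among the [K] old ones. *)
Lemma F_disjoint y z i : C y -> C z -> i \in F y -> i \in F z -> y = z.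
Proof.
move=> Cy Cz /mapP[t /newcopiesP yt ->] /mapP[t' /newcopiesP zt' E].
have /image_codeP Hy := indexP yt; have /image_codeP Hz := indexP zt'.
rewrite -E in Hz; have [_ [j jn tj]] := yt.
have topy u : look (npair v u) K.+1 K = u by rewrite look_push // /update eqxx.
have Ey : tup y t j = y by rewrite /tup tj topy.
have /Hy/Hz[k Ek] : exists k : 'I_n, tup y t k = y by exists (Ordinal jn).
have kK : nth 0 (map val t') k < K.+1.
  by rewrite (nth_map ord0) ?size_tuple ?ltn_ord.
move: Ek; rewrite /tup; move: kK; set l := nth 0 _ _.
rewrite ltnS leq_eqVlt => /orP[/eqP ->|lK]; first by rewrite topy.
have lK1 : l < K.+1 by apply: ltnW.
rewrite look_push // /update (ltn_eqF lK) => El.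
have [inj _] := Cy; have := inj l K lK1 (ltnSn K).
by rewrite topy look_push // /update (ltn_eqF lK) => /(_ El) E'; rewrite E' ltnn in lK.
Qed.

Lemma good_of_F Al B y : C y -> (forall i, i \in F y -> i < B /\ Al i) -> good Al K (npair v y) B.
Proof.
move=> Cy H; split=> // s ss /seq_ordP[s' Es] b [j jn sj] cs.
rewrite Es size_map in ss; have /eqP st := ss; pose t := Tuple st.
have E k : tup y t k = look (npair v y) K.+1 (nth_code (seq_code s) k).
  by rewrite nth_codeE /tup Es.
have yt : newcopy y t.
  split; last by exists j => //; rewrite -[RHS]sj nth_codeE Es.
  by apply: copy_seq_eq cs => k; rewrite E.
have /H[iB Ai] : index y t \in F y by apply: map_f; apply/newcopiesP.
by exists (index y t) => //; split=> //; apply: image_code_eq (indexP yt).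
Qed.

(** The word coded by [z] is in the test when no [y < L] is good for the colouring by its bits. [L]
    bounds both the candidates and the copy indices, so only bits below the leading one are read; a
    prefix of [eps] outside the test yields the desired [y]. *)
Lemma good_exists : exists y B, good (fun i => eps i) K (npair v y) B.
Proof.
have [e_rec _ _ _] := he; have I := rec_id no_oracle; have Hc := rec_const no_oracle.
have [b Hb bP] : decidable_in no_oracle (fun q => ~ exists2 y, y < nfst q &
    good (fun i => odd (nsnd q %/ 2 ^ i)) K (npair v y) (nfst q)).
  apply: dec_not.
  apply: (dec_ex (P := fun q y => good (fun i => odd (nsnd q %/ 2 ^ i)) K (npair v y) (nfst q))).
    apply: (dec_good Xrec n e_rec b0_rec
      (Al := fun q i => odd (nsnd (nfst q) %/ 2 ^ i)) (fK := fun _ => K)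
      (fw := fun q => npair v (nsnd q)) (fB := fun q => nfst (nfst q))) => //.
    - by apply: dec_bool; apply: rec_bit; do ?(apply: rec_snd || apply: rec_fst).
    - by apply: rec_pair => //; apply: rec_snd.
    - by do ?apply: rec_fst.
  exact: rec_fst.
pose T L z := b (npair L z).
have Trec : recursive_in no_oracle (fun q => T (nfst q) (nsnd q)).
  by apply: rec_ext Hb => q; rewrite /T npair_eta.
have TP L z : T L z <-> ~ exists2 y, y < L & good (fun i => odd (z %/ 2 ^ i)) K (npair v y) L.
  by rewrite /T -bP !npairE.
have [|L] := KC_complex_not_test Trec hU heps.
  apply: (small_avoiding_test (C := C) (F := F) (N := #|{: n.-tuple 'I_K.+1}|)).
  - exact: new_infinite.
  - move=> y _; rewrite size_map; apply: leq_trans (_ : size (enum {: n.-tuple 'I_K.+1}) <= _).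
      by rewrite size_filter count_size.
    by rewrite -cardE.
  - by move=> y z i; apply: F_disjoint.
  - move=> L z y /TP nT yL Cy H; apply: nT; exists y => //; exact: good_of_F.
move=> /negP nT; have [y yL gy] : exists2 y, y < L &
    good (fun i => odd ((word_code (mkseq eps L)).+1 %/ 2 ^ i)) K (npair v y) L.
  by apply: NNPP => H; apply: nT; apply/TP.
exists y, L; apply: good_local gy => i iL.
by rewrite word_code_bit ?size_mkseq // nth_mkseq.
Qed.

End Step.

Variables (U : rfun) (eps : nat -> bool).
Hypotheses (hU : universal_prefix U) (heps : KC_complex U eps).

Lemma greedy_embedding : exists nu : nat -> nat, recursive_in eps nu /\
  forall K, exists w B, (forall k, k < K.+1 -> look w K.+1 k = nu k) /\
    good (fun i => eps i) K w B.
Proof.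
have [e_rec _ _ _] := he; have I := rec_id eps.
(* The premise makes a witness exist for every [q], as [rec_choice] requires, even when [q] codes no
   partial embedding. The witness [r] codes the pair of [y] and [B]. *)
pose P q r := partial_embedding ar X (nfst q) (look (nsnd q) (nfst q)) ->
  good (fun i => eps i) (nfst q) (npair (nsnd q) (nfst r)) (nsnd r).
have [||f frec fP] := @rec_choice eps P.
- apply: dec_imp.
    apply: (dec_partial_embedding Xrec (a := fun q => look (nsnd (nfst q)) (nfst (nfst q)))).
      by apply: rec_look; do ?(apply: rec_snd || apply: rec_fst).
    by do ?apply: rec_fst.
  apply: (dec_good Xrec n e_rec (recursive_relative eps b0_rec) (Al := fun _ i => eps i)).
  - apply: (dec_comp (P := fun i => eps i)) (rec_snd I); apply: dec_bool; exists ROracle => x.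
    by have := ev_oracle eps x; case: (eps x).
  - by do ?apply: rec_fst.
  - by apply: rec_pair; do ?(apply: rec_snd || apply: rec_fst).
  - by do ?apply: rec_snd.
- move=> q; case: (classic (partial_embedding ar X (nfst q) (look (nsnd q) (nfst q)))) => H.
    have [y [B HB]] := good_exists hU heps H.
    by exists (npair y B) => _; rewrite !npairE.
  by exists 0 => /H.
pose st K := iteri K (fun k v => npair v (nfst (f (npair k v)))) 0.
pose nu K := nsnd (st K.+1).
have st_rec : recursive_in eps st.
  apply: (rec_iteri (s := fun _ k v => npair v (nfst (f (npair k v))))) (rec_const _ 0) (rec_id eps).
  apply: rec_pair; first exact: rec_snd I.
  apply: rec_fst; apply: (rec_comp frec); apply: rec_pair; last exact: rec_snd I.
  exact: rec_snd (rec_fst I).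
exists nu; split; first by apply: rec_snd; apply: (rec_comp st_rec); apply: rec_succ.
have stS K : st K.+1 = npair (st K) (nu K) by rewrite /nu /= nsnd_pair.
have look_st K : forall k, k < K -> look (st K) K k = nu k.
  elim: K => // K IH k kK; rewrite stS look_push // /update.
  case: eqVneq => [-> //|nk]; apply: IH.
  by move: kK; rewrite ltnS leq_eqVlt (negbTE nk).
have step K : partial_embedding ar X K (look (st K) K) ->
    good (fun i => eps i) K (st K.+1) (nsnd (f (npair K (st K)))).
  by have := fP (npair K (st K)); rewrite /P !npairE stS /nu /= nsnd_pair.
have stP K : partial_embedding ar X K (look (st K) K).
  elim: K => [|K /step[]] //; split=> // i [|//] _ _.
  by [].
move=> K; exists (st K.+1), (nsnd (f (npair K (st K)))); split; [exact: look_st | exact: step].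
Qed.

End Greedy.

Theorem theorem2
  (m : nat) (ar : 'I_m -> nat) (ar_pos : forall i, 0 < ar i)
  (X : structure m nat)
  (Xrec : recursive_structure ar X) (Xhom : homogeneous ar X)
  (Xdense : age_dense ar X)
  (n : nat) (beta : structure m 'I_n) (beta_age : in_age ar X beta)
  (e : nat -> nat) (he : rec_enum_copies ar X beta e)
  (U : rfun) (hU : universal_prefix U)
  (eps : nat -> bool) (heps : KC_complex U eps) :
  exists nu : nat -> nat,
    [/\ embedding ar X X nu,
        recursive_in eps nu &
        forall S : nat -> Prop, copies ar X (fun x => exists y, nu y = x) beta S ->
          forall i, (forall x, S x <-> canon_set (e i) x) -> eps i = true].
Proof.
have [b0' b0X] := beta_age; have [e_rec e_inj e_copy _] := he.
(* For [n = 0] the empty set would be the only copy, and no injective infinite enumeration could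
   exist. Positivity gives each copy a largest index below. *)
have n_gt0 : 0 < n.
  rewrite lt0n; apply/eqP => n0; subst n.
  have E i : e i = 0.
    apply: canon_set_inj => x; have [g [_ [_ Hg]]] := e_copy i.
    by rewrite Hg /canon_set div0n; split=> // [[[]]].
  by have := e_inj 0 1; rewrite !E => /(_ erefl).
pose b0 k := nth 0 (codom b0') k.
have b0E (k : 'I_n) : b0 k = b0' k.
  by rewrite /b0 /codom (nth_map k) ?size_enum_ord // nth_ord_enum.
have b0_emb : embedding ar beta X (fun k : 'I_n => b0 k).
  split=> [k l|i t st]; first by rewrite !b0E; apply: (proj1 b0X).
  by rewrite (eq_map b0E); apply: (proj2 b0X).
(* A finite table is recursive: its entries are read from a constant code. *)
have b0_rec : recursive b0.
  have H := rec_nth_code (rec_const no_oracle (seq_code (codom b0'))) (rec_id no_oracle).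
  by apply: rec_ext H => k; rewrite nth_codeE.
have [nu [nu_rec nuP]] := greedy_embedding Xrec Xhom Xdense b0_emb b0_rec he hU heps.
have nu_part K : partial_embedding ar X K nu.
  have [w [B [Ew [pe _]]]] := nuP K.
  exact: partial_embedding_sub (leqnSn K) (partial_embedding_eq Ew pe).
have nu_emb : embedding ar X X nu.
  split=> [k l|i s ss].
    by apply: (proj1 (nu_part (k + l).+1)); lia.
  have /(_ i s ss) := proj2 (nu_part (\sum_(k <- s) k).+1); rewrite map_id; apply.
  by apply/allP => k ks; rewrite ltnS (big_rem k ks) leq_addr.
exists nu; split=> // S [g [g_nu [g_emb Sg]]] i Si.
pose h k := epsilon (inhabits 0) (fun y => nu y = g k).
have hE k : nu (h k) = g k by apply: (epsilon_spec (inhabits 0) _ (g_nu k)).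
pose s := map h (enum 'I_n).
have ss : size s = n by rewrite size_map size_enum_ord.
have s_nth (k : 'I_n) : nth 0 s k = h k.
  by rewrite (nth_map k) ?size_enum_ord // nth_ord_enum.
(* The copy is complete at the stage of its largest index, so stage [K] has examined it as a copy
   through its new point. *)
pose K := \max_(k <- s) k.
have sK : all (fun k => k < K.+1) s.
  by apply/allP => k ks; rewrite ltnS /K (big_rem k ks) leq_maxl.
have Ks : K \in s.
  rewrite /K; have : s != [::] by rewrite -size_eq0 ss -lt0n.
  elim: (s) => // x [|y t] IH _; rewrite big_cons; first by rewrite big_nil maxn0 inE.
  rewrite inE; case: leqP => _; first by rewrite IH // orbT.
  by rewrite eqxx.
have [w [B [Ew [_ wgood]]]] := nuP K.
have bE (k : 'I_n) : look w K.+1 (nth_code (seq_code s) k) = g k.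
  rewrite nth_codeE Ew ?s_nth ?hE //.
  by have := allP sK (h k); apply; apply: map_f; rewrite mem_enum.
have [||i' _ [epsi' /image_codeP Hi']] := wgood s ss sK.
- by exists (index K s); [rewrite -[X in _ < X]ss index_mem | rewrite nth_codeE nth_index].
- apply/(copy_seqP b0_emb); split=> [k l|j t st]; first by rewrite !bE; apply: (proj1 g_emb).
  by rewrite (eq_map bE); apply: (proj2 g_emb).
suff -> : i = i' by [].
apply: e_inj; apply: canon_set_inj => x; rewrite -Si Sg Hi'.
by split=> [[k <-]|[k <-]]; exists k; rewrite bE.
Qed.
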